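(* Let $(\mathcal{V},\otimes)$ be a quantale whose underlying lattice is a frame. Given a $\mathcal{V}$-graph $X$, the assignment $[n]\mapsto X_n$ extends to a functor $$N_\otimes(X):\Delta^{\mathrm{op}}\to\operatorname{PSh}(\mathcal{V}).$$
   Context: A frame is a complete lattice $\mathcal{V}$ in which finite meets distribute over arbitrary joins; it is viewed as a category with $s\to r$ iff $s$ is below or equal to $r$ in the lattice order. Convention: $r\le s$ means $s\to r$ in $\mathcal{V}$, so $\le$ is the order of $\mathcal{V}^{\mathrm{op}}$; $\inf$ is with respect to $\le$ (join in $\mathcal{V}$). The least element for $\le$ is $0$ (terminal in $\mathcal{V}$) and the greatest is $\infty$. A quantale $(\mathcal{V},\otimes)$ is such a lattice with a monoidal structure $\otimes$ (associative, order preserving) whose unit is $0$ and such that joins commute with $\otimes$ in each variable: $r\otimes\inf_is_i=\inf_i(r\otimes s_i)$ and $(\inf_is_i)\otimes r=\inf_i(s_i\otimes r)$. Empty tensor products are $0$. A $\mathcal{V}$-graph $X$ is a set of vertices with $X(a,b)\in\mathcal{V}$ for each ordered pair, $X(a,a)=0$; a morphism $f:X\to Y$ is a function on vertices with $X(a,b)\ge Y(fa,fb)$. The category is $\mathcal{V}\text{-}\mathbf{Gph}$. For $(r_1,\dots,r_n)\in\mathcal{V}^n$, $\Delta^n_\otimes(r_1,\dots,r_n)$ is the $\mathcal{V}$-graph with vertices $x_0,\dots,x_n$ and distance from $x_i$ to $x_j$ equal to $0$ if $i=j$, $\bigotimes_{i+1\le k\le j}r_k$ if $i<j$, and $\infty$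 otherwise. $\operatorname{PSh}(\mathcal{V})$ is the category of functors $\mathcal{V}^{\mathrm{op}}\to\mathbf{Set}$, and $\Delta$ is the simplex category. For a $\mathcal{V}$-graph $X$ and $n\in\mathbb{N}$, let $\widetilde{X}_n:(\mathcal{V}^{\mathrm{op}})^n\to\mathbf{Set}$ be $\widetilde{X}_n(r_1,\dots,r_n)=\mathcal{V}\text{-}\mathbf{Gph}(\Delta^n_\otimes(r_1,\dots,r_n),X)$, where $(r_i)\le(s_i)$ acts by precomposition with the map $\Delta^n_\otimes(s_1,\dots,s_n)\to\Delta^n_\otimes(r_1,\dots,r_n)$ that is the identity on vertices. Let $\bigotimes:(\mathcal{V}^{\mathrm{op}})^n\to\mathcal{V}^{\mathrm{op}}$ be $(r_1,\dots,r_n)\mapsto\bigotimes_ir_i$. Then $X_n\in\operatorname{PSh}(\mathcal{V})$ is the left Kan extension of $\widetilde{X}_n$ along $\bigotimes$. *)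

(* Defs.v *)
From HB Require Import structures.
From mathcomp Require Import all_boot all_order.
From mathcomp Require Import boolp classical_sets.
From Stdlib Require Import Relation_Operators.

Set Implicit Arguments.
Unset Strict Implicit.
Unset Printing Implicit Defensive.

Import Order.TTheory.
Local Open Scope classical_set_scope.
Local Open Scope order_scope.

(** Throughout, [<=] is the lattice order of [V], so that there is an arrow
    [s -> r] in [V] iff [s <= r].  The order used for "distances" is the
    converse one: the distance [0] is [\top], the distance [oo] is [\bot], and
    an infimum of distances is a join in [V]. *)

HB.mixin Record TBLattice_isComplete (d : Order.disp_t) V
    of Order.TBLattice d V := {
  bigjoin : set V -> V;
  bigjoin_ub : forall (A : set V) (x : V), A x -> x <= bigjoin A;
  bigjoin_le : forall (A : set V) (y : V),
    (forall x, A x -> x <= y) -> bigjoin A <= y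
}.

#[short(type="completeLatticeType")]
HB.structure Definition CompleteLattice (d : Order.disp_t) :=
  { V of Order.TBLattice d V & TBLattice_isComplete d V }.

HB.mixin Record CompleteLattice_isFrame (d : Order.disp_t) V
    of CompleteLattice d V := {
  meet_bigjoin : forall (x : V) (A : set V),
    x `&` bigjoin A = bigjoin [set x `&` a | a in A]
}.

#[short(type="frameType")]
HB.structure Definition Frame (d : Order.disp_t) :=
  { V of CompleteLattice d V & CompleteLattice_isFrame d V }.

HB.mixin Record CompleteLattice_isQuantale (d : Order.disp_t) V
    of CompleteLattice d V := {
  tensor : V -> V -> V;
  tensorA : associative tensor;
  tensor1r : left_id \top tensor;
  tensorr1 : right_id \top tensor;
  tensor_le : forall r r' s s' : V,
    r <= r' -> s <= s' -> tensor r s <= tensor r' s';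
  tensor_bigjoinr : forall (r : V) (A : set V),
    tensor r (bigjoin A) = bigjoin [set tensor r s | s in A];
  tensor_bigjoinl : forall (r : V) (A : set V),
    tensor (bigjoin A) r = bigjoin [set tensor s r | s in A]
}.

#[short(type="quantaleType")]
HB.structure Definition Quantale (d : Order.disp_t) :=
  { V of CompleteLattice d V & CompleteLattice_isQuantale d V }.

#[short(type="frameQuantaleType")]
HB.structure Definition FrameQuantale (d : Order.disp_t) :=
  { V of Frame d V & CompleteLattice_isQuantale d V }.

HB.instance Definition _ (d : Order.disp_t) (V : quantaleType d) :=
  Monoid.isLaw.Build V \top (@tensor d V) tensorA tensor1r tensorr1.

Record category := Category {
  obj :> Type;
  hom : obj -> obj -> Type;
  idm : forall x, hom x x;
  comp : forall x y z, hom y z -> hom x y -> hom x z;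
  comp1m : forall x y (f : hom x y), comp (idm y) f = f;
  compm1 : forall x y (f : hom x y), comp f (idm x) = f;
  compA : forall w x y z (h : hom y z) (g : hom x y) (f : hom w x),
    comp h (comp g f) = comp (comp h g) f
}.

Arguments idm {_} x.
Arguments comp {_ x y z} g f.

Definition op_cat (C : category) : category :=
  @Category C (fun x y => @hom C y x) (fun x => idm x)
    (fun _ _ _ g f => comp f g)
    (fun _ _ f => compm1 f) (fun _ _ f => comp1m f)
    (fun _ _ _ _ h g f => esym (compA f g h)).

Record functor (C D : category) := Functor {
  fobj :> C -> D;
  fmap : forall x y, hom x y -> hom (fobj x) (fobj y);
  fmap1 : forall x, fmap (idm x) = idm (fobj x);
  fmapM : forall x y z (g : hom y z) (f : hom x y),
    fmap (comp g f) = comp (fmap g) (fmap f)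
}.

Arguments fmap {C D} F {x y} f : rename.

Record nat_trans (C D : category) (F G : functor C D) := NatTrans {
  ntmap :> forall x, hom (F x) (G x);
  ntmapP : forall x y (f : hom x y),
    comp (ntmap y) (fmap F f) = comp (fmap G f) (ntmap x)
}.

Lemma nat_transP (C D : category) (F G : functor C D) (a b : nat_trans F G) :
  (forall x, a x = b x) -> a = b.
Proof.
case: a b => [a pa] [b pb] /= ab.
have {}ab : a = b by apply: functional_extensionality_dep.
by case: _ / ab pb => pb; congr NatTrans; apply: Prop_irrelevance.
Qed.

Definition nat_id (C D : category) (F : functor C D) : nat_trans F F :=
  @NatTrans C D F F (fun x => idm (F x))
    (fun x y f => etrans (comp1m _) (esym (compm1 _))).

Program Definition nat_comp (C D : category) (F G H : functor C D)
    (b : nat_trans G H) (a : nat_trans F G) : nat_trans F H :=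
  @NatTrans C D F H (fun x => comp (b x) (a x)) _.
Next Obligation. by rewrite -compA ntmapP compA ntmapP compA. Qed.

Program Definition functor_cat (C D : category) : category :=
  @Category (functor C D) (@nat_trans C D) (@nat_id C D) (@nat_comp C D)
    _ _ _.
Next Obligation. by apply: nat_transP => z; apply: comp1m. Qed.
Next Obligation. by apply: nat_transP => z; apply: compm1. Qed.
Next Obligation. by apply: nat_transP => t; apply: compA. Qed.

Program Definition functor_comp (C D E : category)
    (G : functor D E) (F : functor C D) : functor C E :=
  @Functor C E (fun x => G (F x)) (fun _ _ f => fmap G (fmap F f)) _ _.
Next Obligation. by rewrite !fmap1. Qed.
Next Obligation. by rewrite !fmapM. Qed.

Definition whisker (C D E : category) (G H : functor D E)
    (a : nat_trans G H) (F : functor C D) :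
    nat_trans (functor_comp G F) (functor_comp H F) :=
  @NatTrans C E (functor_comp G F) (functor_comp H F) (fun x => a (F x))
    (fun _ _ f => ntmapP a (fmap F f)).

Definition is_left_kan_extension (C D E : category)
    (K : functor C D) (F : functor C E)
    (L : functor D E) (eta : nat_trans F (functor_comp L K)) : Prop :=
  forall (G : functor D E) (gamma : nat_trans F (functor_comp G K)),
    exists! alpha : nat_trans L G, nat_comp (whisker alpha K) eta = gamma.

Definition set_cat : category :=
  @Category Type (fun A B => A -> B) (fun A x => x) (fun A B C g f x => g (f x))
    (fun _ _ _ => erefl) (fun _ _ _ => erefl) (fun _ _ _ _ _ _ _ => erefl).

Definition poset_cat (d : Order.disp_t) (P : porderType d) : category :=
  @Category P (fun x y => x <= y) (@lexx d P) (fun x y z g f => le_trans f g)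
    (fun _ _ _ => Prop_irrelevance _ _) (fun _ _ _ => Prop_irrelevance _ _)
    (fun _ _ _ _ _ _ _ => Prop_irrelevance _ _).

Program Definition pow_cat (C : category) (n : nat) : category :=
  @Category ('I_n -> C) (fun x y => forall i, hom (x i) (y i))
    (fun x i => idm (x i)) (fun _ _ _ g f i => comp (g i) (f i)) _ _ _.
Next Obligation. by apply: functional_extensionality_dep => i; apply: comp1m. Qed.
Next Obligation. by apply: functional_extensionality_dep => i; apply: compm1. Qed.
Next Obligation. by apply: functional_extensionality_dep => i; apply: compA. Qed.

Definition PSh (d : Order.disp_t) (V : porderType d) : category :=
  functor_cat (op_cat (poset_cat V)) set_cat.

(** The simplex category: the natural number [n] stands for [[n] = {0,...,n}]. *)

Definition simplex_hom (m n : nat) : Type :=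
  {f : 'I_m.+1 -> 'I_n.+1 | {homo f : i j / (i <= j)%N}}.

Program Definition simplex_cat : category :=
  @Category nat simplex_hom (fun n => exist _ id _)
    (fun m n p g f => exist _ (sval g \o sval f) _) _ _ _.
Next Obligation. by []. Qed.
Next Obligation. by move=> i j ij /=; apply: (svalP g); apply: (svalP f). Qed.
Next Obligation. by case: f => f pf; apply: eq_exist. Qed.
Next Obligation. by case: f => f pf; apply: eq_exist. Qed.
Next Obligation. by apply: eq_exist. Qed.

Section Graphs.
Context {d : Order.disp_t} (V : quantaleType d).

Record vgraph := VGraph {
  vertex :> Type;
  dist : vertex -> vertex -> V;
  dist_refl : forall a, dist a a = \top
}.

Record vgraph_hom (X Y : vgraph) := VGraphHom {
  vmap :> X -> Y;
  vmap_dist : forall a b : X, dist a b <= dist (vmap a) (vmap b)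
}.

Lemma vgraph_homP (X Y : vgraph) (f g : vgraph_hom X Y) :
  vmap f = vmap g -> f = g.
Proof.
case: f g => [f pf] [g pg] /= fg.
by case: _ / fg pg => pg; congr VGraphHom; apply: Prop_irrelevance.
Qed.

Definition vgraph_id (X : vgraph) : vgraph_hom X X :=
  @VGraphHom X X id (fun a b => lexx (dist a b)).

Definition vgraph_comp (X Y Z : vgraph)
    (g : vgraph_hom Y Z) (f : vgraph_hom X Y) : vgraph_hom X Z :=
  @VGraphHom X Z (fun a => g (f a))
    (fun a b => le_trans (vmap_dist f a b) (vmap_dist g (f a) (f b))).

(** The weight [r_k] of the edge from [x_(k-1)] to [x_k] is [r (k - 1)], as
    ordinals start at [0]; hence the condition [i <= k < j] below. *)

Definition simplex_dist (n : nat) (r : 'I_n -> V) (i j : 'I_n.+1) : V :=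
  if i == j then \top
  else if (i < j)%N then \big[@tensor d V / \top]_(k < n | (i <= k < j)%N) r k
  else \bot.

Lemma simplex_dist_refl (n : nat) (r : 'I_n -> V) (i : 'I_n.+1) :
  simplex_dist r i i = \top.
Proof. by rewrite /simplex_dist eqxx. Qed.

Definition tensor_simplex (n : nat) (r : 'I_n -> V) : vgraph :=
  @VGraph 'I_n.+1 (simplex_dist r) (simplex_dist_refl r).

Lemma le_big_tensor (n : nat) (P : pred 'I_n) (r s : 'I_n -> V) :
  (forall i, s i <= r i) ->
  \big[@tensor d V / \top]_(k < n | P k) s k
    <= \big[@tensor d V / \top]_(k < n | P k) r k.
Proof.
by move=> sr; apply: (big_ind2 (fun x y : V => x <= y)) => // *; apply: tensor_le.
Qed.

Lemma simplex_id_subproof (n : nat) (r s : 'I_n -> V)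
    (sr : forall i, s i <= r i) (i j : tensor_simplex s) :
  dist i j <= @dist (tensor_simplex r) i j.
Proof.
rewrite /= /simplex_dist; case: eqP => // _; case: ifP => // _.
exact: le_big_tensor.
Qed.

Definition simplex_id (n : nat) (r s : 'I_n -> V)
    (sr : forall i, s i <= r i) :
    vgraph_hom (tensor_simplex s) (tensor_simplex r) :=
  @VGraphHom (tensor_simplex s) (tensor_simplex r) id
    (simplex_id_subproof sr).

Definition Vop : category := op_cat (poset_cat V).

Lemma Vop_irr (x y : Vop) (f g : hom x y) : f = g.
Proof. exact: (@Prop_irrelevance (is_true _)). Qed.

Definition tensor_functor (n : nat) : functor (pow_cat Vop n) Vop :=
  @Functor (pow_cat Vop n) Vop (fun r => \big[@tensor d V / \top]_(k < n) r k)
    (fun r s rs => le_big_tensor xpredT rs)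
    (fun _ => Vop_irr _ _) (fun _ _ _ _ _ => Vop_irr _ _).

Program Definition tildeX (X : vgraph) (n : nat) :
    functor (pow_cat Vop n) set_cat :=
  @Functor (pow_cat Vop n) set_cat
    (fun r => vgraph_hom (tensor_simplex r) X)
    (fun r s rs f => vgraph_comp f (simplex_id rs)) _ _.
Next Obligation. by apply: funext => h; apply: vgraph_homP. Qed.
Next Obligation. by apply: funext => h; apply: vgraph_homP. Qed.

(** The left Kan extension of [tildeX X n] along [tensor_functor n] exists:
    at [t] it is the quotient of the set of triples
    [(r, \big[tensor]_k r k -> t in V^op, f : Delta^n(r) -> X)]
    by the relation generated by the action of [(V^op)^n]. *)

Section LeftKanExtension.
Variables (X : vgraph) (n : nat).

Let T (t : V) : Type :=
  {r : 'I_n -> V & (prod (t <= tensor_functor n r) (tildeX X n r))}.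

Inductive lan_step (t : V) : T t -> T t -> Prop :=
  LanStep (r s : 'I_n -> V) (u : @hom (pow_cat Vop n) r s)
    (p : t <= tensor_functor n r) (q : t <= tensor_functor n s)
    (x : tildeX X n r) :
  lan_step (existT _ r (p, x)) (existT _ s (q, fmap (tildeX X n) u x)).

Let E (t : V) := clos_refl_sym_trans (T t) (@lan_step t).

Let Q (t : V) : Type := {c : T t -> Prop | exists x, c = E x}.

Let cls (t : V) (x : T t) : Q t := exist _ (E x) (ex_intro _ x erefl).

Let rep (t : V) (c : Q t) : T t := sval (cid (svalP c)).

Let clsP (t : V) (x y : T t) : E x y -> cls x = cls y.
Proof.
move=> xy; apply: eq_exist; apply: funext => z; apply/propext; split => h.
  by apply: rst_trans h; apply: rst_sym.
exact: rst_trans xy h.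
Qed.

Let repK (t : V) (c : Q t) : cls (rep c) = c.
Proof.
case: c => c pc; rewrite /rep /=; case: cid => x /= e.
by apply: eq_exist; rewrite e.
Qed.

Let repE (t : V) (x : T t) : E (rep (cls x)) x.
Proof.
rewrite /rep; case: cid => y /= e.
by rewrite -e; apply: rst_refl.
Qed.

Let act (t t' : V) (le_t : t' <= t) (x : T t) : T t' :=
  existT _ (projT1 x) (le_trans le_t (projT2 x).1, (projT2 x).2).

Let actE (t t' : V) (le_t : t' <= t) (x y : T t) :
  E x y -> E (act le_t x) (act le_t y).
Proof.
elim=> {x y} [_ _ [r s u p q x]|x|x y _ h|x y z _ h _ h'].
- exact/rst_step/LanStep.
- exact: rst_refl.
- exact: rst_sym.
- exact: rst_trans h h'.
Qed.

Let actQ (t t' : V) (le_t : t' <= t) (c : Q t) : Q t' := cls (act le_t (rep c)).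

Let actQ_cls (t t' : V) (le_t : t' <= t) (x : T t) :
  actQ le_t (cls x) = cls (act le_t x).
Proof. exact/clsP/actE/repE. Qed.

Program Definition lan_functor : functor Vop set_cat :=
  @Functor Vop set_cat Q (fun t t' => @actQ t t') _ _.
Next Obligation.
apply: funext => c /=; rewrite -(repK c) actQ_cls; congr cls.
by case: (rep c) => r [p f]; congr existT; congr pair; apply: Prop_irrelevance.
Qed.
Next Obligation.
apply: funext => c /=; rewrite -(repK c) !actQ_cls; congr cls.
by case: (rep c) => r [p h]; congr existT; congr pair; apply: Prop_irrelevance.
Qed.

Program Definition lan_unit :
    nat_trans (tildeX X n) (functor_comp lan_functor (tensor_functor n)) :=
  @NatTrans _ _ (tildeX X n) (functor_comp lan_functor (tensor_functor n))
    (fun r f => cls (existT _ r (lexx _, f))) _.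
Next Obligation.
apply: funext => h /=; rewrite actQ_cls; apply/esym/clsP/rst_step.
exact: (LanStep f).
Qed.

Lemma lan_unitP : is_left_kan_extension lan_unit.
Proof.
move=> G gamma.
pose g t (x : T t) : G t :=
  @fmap _ _ G (tensor_functor n (projT1 x)) t (projT2 x).1
    (gamma (projT1 x) (projT2 x).2).
have gE t (x y : T t) : E x y -> g t x = g t y.
  elim=> {x y} [_ _ [r s u p q x]|x|x y _ h|x y z _ h _ h'] //; last first.
    by rewrite h.
  rewrite /g /=.
  have /= -> := congr1 (fun k => k x) (ntmapP gamma u).
  have /= <- := congr1 (fun k => k (gamma r x))
    (fmapM G (q : @hom Vop (tensor_functor n s) t) (fmap (tensor_functor n) u)).
  by congr (fmap G _ _); apply: Vop_irr.
have gcls t (x : T t) : g t (rep (cls x)) = g t x by apply/gE/repE.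
have gN (t t' : Vop) (u : hom t t') :
    @comp set_cat _ _ _ (fun c => g t' (rep c)) (fmap lan_functor u)
    = @comp set_cat _ _ _ (fmap G u) (fun c => g t (rep c)).
  apply: funext => c /=; rewrite gcls /g /=.
  have /= <- := congr1 (fun k => k (gamma _ (projT2 (rep c)).2))
    (fmapM G u ((projT2 (rep c)).1 : @hom Vop (tensor_functor n _) t)).
  by congr (fmap G _ _); apply: Vop_irr.
exists (@NatTrans _ _ lan_functor G (fun t c => g t (rep c)) gN); split.
  apply: nat_transP => r; apply: funext => f /=; rewrite gcls /g /=.
  have /= := congr1 (fun k => k (gamma r f)) (fmap1 G (tensor_functor n r)).
  by move=> h; rewrite -[RHS]h; congr (fmap G _ _); apply: Vop_irr.
move=> alpha halpha; apply: nat_transP => t; apply: funext => c /=.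
rewrite -(repK c) gcls; case: (rep c) => r [p f].
rewrite /g /= -halpha /=.
have /= <- := congr1 (fun k => k (lan_unit r f))
  (ntmapP alpha (p : @hom Vop (tensor_functor n r) t)).
congr (alpha t _); rewrite /lan_unit /= actQ_cls; congr cls.
by congr existT; congr pair; apply: Prop_irrelevance.
Qed.

End LeftKanExtension.

End Graphs.

(* Main.v *)
From mathcomp Require Import all_boot all_order.
From mathcomp Require Import boolp.
Require Import Defs.

(** Restriction along a monotone [theta : [m] -> [n]] sends [Delta^n(r) -> X]
    to [Delta^m(theta^* r) -> X], where the [i]-th weight of [theta^* r] is the
    tensor of the [r_k] with [theta (i-1) < k <= theta i]: associativity of the
    tensor makes [theta] itself a morphism [Delta^m(theta^* r) -> Delta^n(r)].
    As the unit is the top element, the tensor of [r] lies below that of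
    [theta^* r], so this restriction followed by the unit of [X_m] is a
    transformation from [tildeX n] to [X_m] precomposed with the tensor, which
    factors through the Kan extension [X_n].  Functoriality follows from the
    uniqueness of these factorizations. *)

Set Implicit Arguments.
Unset Strict Implicit.
Unset Printing Implicit Defensive.

Import Order.TTheory.
Local Open Scope order_scope.

(** Adjacent blocks concatenate in order, so associativity and the unit suffice. *)
Lemma telescope_big_nat (T : Type) (idx : T) (op : Monoid.law idx)
    (F : nat -> T) (t : nat -> nat) (i j : nat) :
  {homo t : a b / (a <= b)%N} -> (i <= j)%N ->
  \big[op/idx]_(i <= l < j) \big[op/idx]_(t l <= k < t l.+1) F k
    = \big[op/idx]_(t i <= k < t j) F k.
Proof.
move=> t_mono; elim: j => [|j IHj]; first by rewrite leqn0 => /eqP->; rewrite !big_geq.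
rewrite leq_eqVlt => /predU1P[->|ij]; first by rewrite !big_geq.
rewrite big_nat_recr //= IHj // -big_cat_nat //; exact: t_mono.
Qed.

(** Over [nat] the intervals can be cut and glued; the default [idx] is never reached since
    [b <= n]. *)
Lemma big_ord_interval (T : Type) (idx : T) (op : Monoid.law idx)
    (n : nat) (r : 'I_n -> T) (a b : nat) : (b <= n)%N ->
  \big[op/idx]_(k < n | (a <= k < b)%N) r k
    = \big[op/idx]_(a <= k < b) oapp r idx (insub k).
Proof.
move=> bn; rewrite (big_nat_widen _ _ _ _ _ bn) big_geq_mkord.
by apply: eq_big => [k|k _]; rewrite ?valK //= andbC.
Qed.

Lemma lan_ext (C D E : category) (K : functor C D) (F : functor C E)
    (L : functor D E) (eta : nat_trans F (functor_comp L K)) (G : functor D E)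
    (a b : nat_trans L G) :
  is_left_kan_extension eta ->
  (forall x, comp (a (K x)) (eta x) = comp (b (K x)) (eta x)) -> a = b.
Proof.
move=> etaP ab; have [c [_ c_uniq]] := etaP G (nat_comp (whisker b K) eta).
by rewrite -(c_uniq b erefl); apply/esym/c_uniq/nat_transP => x; apply: ab.
Qed.

Section Restriction.
Context {d : Order.disp_t} (V : quantaleType d).

(** The two ordinals under [theta] are the endpoints [i] and [i + 1] of an edge of [[m]]; a
    collapsed edge gets the empty tensor [\top]. *)
Definition restr_weight (m n : nat) (theta : simplex_hom m n) (r : 'I_n -> V)
    (i : 'I_m) : V :=
  \big[@tensor d V / \top]_(k < n |
    (sval theta (widen_ord (leqnSn m) i) <= k < sval theta (lift ord0 i))%N) r k.

Lemma big_restr_weight (m n : nat) (theta : simplex_hom m n) (r : 'I_n -> V)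
    (i j : 'I_m.+1) : (i <= j)%N ->
  \big[@tensor d V / \top]_(l < m | (i <= l < j)%N) restr_weight theta r l
    = \big[@tensor d V / \top]_(k < n |
        (sval theta i <= k < sval theta j)%N) r k.
Proof.
(* [t] extends [theta] to all naturals, constant beyond [m], so that it stays monotone and
   telescoping applies. *)
move=> ij; pose t l : nat := sval theta (inord (minn l m)).
have t_mono : {homo t : a b / (a <= b)%N}.
  move=> a b ab; apply: (svalP theta).
  rewrite !inordK ?ltnS ?geq_minr // leq_min geq_minr andbT.
  exact: leq_trans (geq_minl _ _) ab.
have tE (l : 'I_m.+1) : t l = sval theta l.
  by rewrite /t (minn_idPl _) ?inord_val // -ltnS.
rewrite [RHS]big_ord_interval -1?ltnS // -!tE -(telescope_big_nat _ _ t_mono ij).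
rewrite big_ord_interval -1?ltnS //; apply: eq_big_nat => l /andP[_ lj].
have lm : (l < m)%N by apply: leq_trans lj _; rewrite -ltnS.
rewrite insubT /= /restr_weight big_ord_interval -1?ltnS // -!tE.
by rewrite /= /bump leq0n add1n.
Qed.

Lemma restr_weight_dist (m n : nat) (theta : simplex_hom m n) (r : 'I_n -> V)
    (i j : tensor_simplex (restr_weight theta r)) :
  dist i j <= @dist d V (tensor_simplex r) (sval theta i) (sval theta j).
Proof.
rewrite /= /simplex_dist; case: eqP => [->|_]; first by rewrite eqxx.
case: ifP => [ij|_]; last exact: le0x.
rewrite big_restr_weight ?(ltnW ij) //.
(* If [theta] identifies [i] and [j], the target value is [\top]; otherwise both sides are the same
   tensor. *)
case: eqP => [_|/eqP tij]; first exact: lex1.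
by rewrite ltn_neqAle tij (svalP theta) ?(ltnW ij).
Qed.

Definition simplex_restr (m n : nat) (theta : simplex_hom m n) (r : 'I_n -> V) :
    vgraph_hom (tensor_simplex (restr_weight theta r)) (tensor_simplex r) :=
  @VGraphHom d V (tensor_simplex (restr_weight theta r)) (tensor_simplex r)
    (sval theta) (@restr_weight_dist m n theta r).

Lemma le_restr_weight (m n : nat) (theta : simplex_hom m n) (r s : 'I_n -> V) :
  (forall i, s i <= r i) ->
  forall i, restr_weight theta s i <= restr_weight theta r i.
Proof. by move=> sr i; apply: le_big_tensor. Qed.

(** Each dropped factor is replaced by the unit, which is the greatest element. *)
Lemma big_tensor_subset (n : nat) (P : pred 'I_n) (r : 'I_n -> V) :
  \big[@tensor d V / \top]_(k < n) r k
    <= \big[@tensor d V / \top]_(k < n | P k) r k.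
Proof.
rewrite [leRHS]big_mkcond; apply: le_big_tensor => i.
by case: (P i) => //; apply: lex1.
Qed.

Lemma le_tensor_restr (m n : nat) (theta : simplex_hom m n) (r : 'I_n -> V) :
  tensor_functor V n r <= tensor_functor V m (restr_weight theta r).
Proof.
(* Telescoping from [0] to [m] leaves the factors between [theta 0] and [theta m]. *)
have := @big_restr_weight m n theta r ord0 ord_max isT.
under eq_bigl => l do rewrite leq0n /= ltn_ord.
by rewrite /= => ->; apply: big_tensor_subset.
Qed.

Lemma restr_weight_id (n : nat) (r : 'I_n -> V) (i : 'I_n) :
  restr_weight (idm (n : simplex_cat)) r i = r i.
Proof.
rewrite /restr_weight (big_pred1 i) // => k.
by rewrite /= /bump leq0n add1n ltnS -eqn_leq eq_sym.
Qed.

(** The outer weight is a tensor over an interval with endpoints in the image of [phi], so it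
    telescopes. *)
Lemma restr_weight_comp (m n p : nat) (theta : simplex_hom m n)
    (phi : simplex_hom p m) (r : 'I_n -> V) (i : 'I_p) :
  restr_weight phi (restr_weight theta r) i
    = restr_weight (@comp simplex_cat p m n theta phi) r i.
Proof.
rewrite [LHS]big_restr_weight //; apply: (svalP phi).
by rewrite /= /bump leq0n add1n.
Qed.

Local Notation act F := (@fmap (Vop V) set_cat F _ _).

Variables (X : vgraph V) (Xn : nat -> PSh V).
Variable eta : forall n,
  nat_trans (tildeX X n) (functor_comp (Xn n) (tensor_functor V n)).

(* Stated for [s <= r] so that weights which are only propositionally equal can
   be compared without transport. *)
Lemma eta_le (n : nat) (r s : 'I_n -> V) (t : Vop V)
    (p : @hom (Vop V) (tensor_functor V n r) t)
    (q : @hom (Vop V) (tensor_functor V n s) t)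
    (f : tildeX X n r) (g : tildeX X n s) :
  (forall i, s i <= r i) -> vmap f = vmap g ->
  act (Xn n) p (eta n r f) = act (Xn n) q (eta n s g).
Proof.
move=> sr fg; pose u : @hom (pow_cat (Vop V) n) r s := sr.
have -> : g = @fmap _ set_cat (tildeX X n) _ _ u f by apply: vgraph_homP; rewrite -fg.
have /= -> := congr1 (fun k => k f) (ntmapP (eta n) u).
have /= <- := congr1 (fun k => k (eta n r f))
  (fmapM (Xn n) q (fmap (tensor_functor V n) u)).
by congr (act (Xn n) _ _); apply: Vop_irr.
Qed.

(** [h] may be any arrow, as parallel arrows of a poset agree. *)
Lemma psh_fmap_fmap (F : PSh V) (x y z : Vop V) (g : hom y z) (f : hom x y)
    (h : hom x z) (c : fobj F x) :
  act F g (act F f c) = act F h c.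
Proof.
have /= <- := congr1 (fun k => k c) (fmapM F g f).
by congr (act F _ _); apply: Vop_irr.
Qed.

Definition restr_cell (m n : nat) (theta : simplex_hom m n) (r : 'I_n -> V)
    (f : tildeX X n r) : Xn m (tensor_functor V n r) :=
  @fmap (Vop V) set_cat (Xn m) (tensor_functor V m (restr_weight theta r))
    (tensor_functor V n r) (le_tensor_restr theta r)
    (eta m (restr_weight theta r) (vgraph_comp f (simplex_restr theta r))).

Lemma restr_cell_natural (m n : nat) (theta : simplex_hom m n)
    (r s : pow_cat (Vop V) n) (u : hom r s) :
  @comp set_cat _ _ _ (@restr_cell m n theta s) (fmap (tildeX X n) u)
    = @comp set_cat _ _ _
        (fmap (functor_comp (Xn m) (tensor_functor V n)) u)
        (@restr_cell m n theta r).
Proof.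
apply: funext => f; rewrite /= /restr_cell.
rewrite (psh_fmap_fmap _ _ (le_trans (le_big_tensor xpredT u) (le_tensor_restr theta r))).
by apply/esym/eta_le => //; apply: le_restr_weight.
Qed.

Definition restr_trans (m n : nat) (theta : simplex_hom m n) :
    nat_trans (tildeX X n) (functor_comp (Xn m) (tensor_functor V n)) :=
  @NatTrans _ _ (tildeX X n) (functor_comp (Xn m) (tensor_functor V n))
    (@restr_cell m n theta) (@restr_cell_natural m n theta).

Hypothesis Xn_lan : forall n, is_left_kan_extension (eta n).

Definition nerve_map (m n : nat) (theta : simplex_hom m n) :
    nat_trans (Xn n) (Xn m) :=
  sval (cid (Xn_lan (restr_trans theta))).

Lemma nerve_map_eta (m n : nat) (theta : simplex_hom m n) (r : 'I_n -> V)
    (f : tildeX X n r) :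
  nerve_map theta (tensor_functor V n r) (eta n r f) = restr_cell theta f.
Proof.
rewrite /nerve_map; case: cid => a /= [aE _].
exact: (congr1 (fun b : nat_trans (tildeX X n) _ => b r f) aE).
Qed.

Lemma nerve_map_id (n : nat) : nerve_map (idm (n : simplex_cat)) = nat_id (Xn n).
Proof.
apply: (lan_ext (Xn_lan (n := n))) => r; apply: funext => f.
rewrite /= nerve_map_eta /restr_cell.
(* Restricting along the identity keeps the vertex map; only an identity action remains. *)
rewrite (eta_le _ (lexx _) (g := f)) //; last by move=> i; rewrite restr_weight_id.
exact: (congr1 (fun k => k _) (fmap1 (Xn n) (tensor_functor V n r))).
Qed.

Lemma nerve_map_comp (m n p : nat) (theta : simplex_hom m n) (phi : simplex_hom p m) :
  nerve_map (@comp simplex_cat p m n theta phi) = nat_comp (nerve_map phi) (nerve_map theta).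
Proof.
apply: (lan_ext (Xn_lan (n := n))) => r; apply: funext => f.
rewrite /= !nerve_map_eta /restr_cell.
(* Naturality moves [nerve_map phi] past the presheaf action, onto a value of [eta m]. *)
have /= -> := congr1 (fun k => k (eta m _ (vgraph_comp f (simplex_restr theta r))))
  (ntmapP (nerve_map phi) (le_tensor_restr theta r : @hom (Vop V)
     (tensor_functor V m (restr_weight theta r)) (tensor_functor V n r))).
rewrite nerve_map_eta /restr_cell.
rewrite (psh_fmap_fmap _ _ (le_trans (le_tensor_restr theta r) (le_tensor_restr phi _))).
by apply: eta_le => // i; rewrite restr_weight_comp.
Qed.

(** The object part is [Xn] itself, so agreement on objects holds by computation. *)
Definition nerve : functor (op_cat simplex_cat) (PSh V) :=
  @Functor (op_cat simplex_cat) (PSh V) Xn (fun n m => @nerve_map m n)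
    nerve_map_id (fun n m p phi theta => nerve_map_comp theta phi).

End Restriction.

Theorem proposition14 (d : Order.disp_t) (V : frameQuantaleType d)
    (X : vgraph V)
    (Xn : nat -> PSh V)
    (eta : forall n : nat,
      nat_trans (tildeX X n) (functor_comp (Xn n) (tensor_functor V n)))
    (Xn_lan : forall n : nat, is_left_kan_extension (eta n)) :
  exists N : functor (op_cat simplex_cat) (PSh V),
    forall n : nat, N n = Xn n.
Proof. by exists (nerve Xn_lan). Qed.
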